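(* Let $\mathcal{C}\subset[0,1]$ be the Cantor ternary set and let $$K=\left(\mathcal{C}\times[0,1]^2\right)\cup\left([0,1]\times\{0\}\times[0,1]\right)\cup\left([0,1]^2\times\{0\}\right)\subset\mathbb{R}^3.$$ Then $K$ is a continuum, and $K$ has no core decomposition with Peano quotient.
   Context: A compactum is a compact metric space; a continuum is a connected compactum; a Peano continuum is a locally connected continuum. A Peano compactum is a compact metric space all of whose components are Peano continua and such that for every $C>0$ all but finitely many of its components have diameter less than $C$. An upper semi-continuous decomposition $\mathcal{D}$ of a compactum $K$ is a partition of $K$ such that for every open set $B\subset K$ the union of all $d\in\mathcal{D}$ with $d\subset B$ is open in $K$; it carries the quotient topology from the natural projection $\pi:K\to\mathcal{D}$. It is a monotone decomposition if each of its elements is a subcontinuum of $K$; then the quotient is a compact metrizable space, regarded as a compactum with a compatible metric. If $\mathcal{D},\mathcal{D}'$ are monotone decompositions of $K$ with projections $\pi,\pi'$, then $\mathcal{D}$ is finer than $\mathcal{D}'$ if there is a map $g:\mathcal{D}\to\mathcal{D}'$ with $\pi'=g\circ\pi$. A core decomposition of $K$ with Peano quotient is a monotone decomposition of $K$ whose quotient space is a Peano compactum and which is finer than every other monotone decomposition of $K$ whose quotient space is a Peano compactum. *)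

(* Defs.v *)
From HB Require Import structures.
From mathcomp Require Import all_boot all_order all_algebra.
From mathcomp Require Import all_classical all_reals all_analysis.
Import Order.TTheory GRing.Theory Num.Theory.
Import numFieldNormedType.Exports.

Set Implicit Arguments.
Unset Strict Implicit.
Unset Printing Implicit Defensive.

Local Open Scope classical_set_scope.
Local Open Scope ring_scope.

(* Only used for subsets of metrizable spaces, so that metrizability of [A] is
   inherited from the ambient space. *)
Definition continuum (T : topologicalType) (A : set T) : Prop :=
  compact A /\ connected A.

Definition locally_connected (T : topologicalType) : Prop :=
  forall (x : T) (U : set T), nbhs x U ->
    exists V : set T, [/\ open V, V x, connected V & V `<=` U].

(* [set_type A] carries the topology induced by [T]. *)
Definition peano_continuum (T : topologicalType) (A : set T) : Prop :=
  continuum A /\ locally_connected (set_type A).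

Definition components (T : topologicalType) : set (set T) :=
  range (connected_component [set: T]).

Arguments components T : clear implicits.

Definition diameter (R : realType) (M : metricType R) (A : set M) : \bar R :=
  ereal_sup [set (mdist p.1 p.2)%:E | p in A `*` A].

Definition peano_compactum (R : realType) (M : metricType R) : Prop :=
  [/\ compact [set: M],
      forall A, components M A -> peano_continuum A &
      forall C : R, 0 < C ->
        finite_set [set A | components M A /\ ~ (diameter A < C%:E)%E]].

Definition homeomorphic (X Y : topologicalType) : Prop :=
  exists (f : X -> Y) (g : Y -> X),
    [/\ continuous f, continuous g, cancel f g & cancel g f].

Record usc_decomposition (T : topologicalType) := UscDecomposition {
  blocks :> set (set T);
  blocks_partition : classical_sets.partition blocks id [set: T];
  blocks_usc : forall B : set T, open B ->
    open (\bigcup_(d in [set d | blocks d /\ d `<=` B]) d)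
}.

Section projection.
Context (T : topologicalType) (D : usc_decomposition T).

(* The type whose points are the elements of [D]. *)
Definition block_type : Type := set_type D.

Lemma block_exists (x : T) : exists d : block_type, set_val d x.
Proof.
have [cov _ _] := blocks_partition D.
have [d Dd dx] : cover (blocks D) id x by rewrite cov.
by exists (SigSub (mem_set Dd)).
Qed.

Lemma block_nonempty (d : block_type) : exists x, set_val d x.
Proof. by have [_ _ +] := blocks_partition D; apply; exact: set_valP. Qed.

Definition block_of (x : T) : block_type := sval (cid (block_exists x)).

Definition block_repr (d : block_type) : T := sval (cid (block_nonempty d)).

Lemma block_of_mem (x : T) : set_val (block_of x) x.
Proof. exact: svalP (cid (block_exists x)). Qed.

Lemma block_reprK : cancel block_repr block_of.
Proof.
move=> d; have [_ triv _] := blocks_partition D.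
apply: val_inj; apply: triv; [exact: set_valP|exact: set_valP|].
exists (block_repr d); split; first exact: block_of_mem.
exact: svalP (cid (block_nonempty d)).
Qed.

HB.instance Definition _ := isQuotient.Build T block_type block_reprK.

End projection.

Definition quotient_space (T : topologicalType) (D : usc_decomposition T) :
  topologicalType := quotient_topology (block_type D).

Definition natural_projection (T : topologicalType) (D : usc_decomposition T) :
  T -> quotient_space D := @block_of T D.

Definition monotone_decomposition (T : topologicalType)
    (D : usc_decomposition T) : Prop :=
  forall d, blocks D d -> continuum d.

(* Some compatible metric makes the quotient a Peano compactum; on a compact
   metrizable space this does not depend on the compatible metric. *)
Definition has_peano_quotient (R : realType) (T : topologicalType)
    (D : usc_decomposition T) : Prop :=
  exists M : metricType R,
    homeomorphic (quotient_space D) M /\ peano_compactum M.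

(* A factorization [g] is automatically continuous, by the universal property
   of the quotient topology. *)
Definition finer (T : topologicalType) (D D' : usc_decomposition T) : Prop :=
  exists g : quotient_space D -> quotient_space D',
    natural_projection D' = g \o natural_projection D.

Definition core_decomposition (R : realType) (T : topologicalType)
    (D : usc_decomposition T) : Prop :=
  [/\ monotone_decomposition D,
      has_peano_quotient R D &
      forall D' : usc_decomposition T,
        monotone_decomposition D' -> has_peano_quotient R D' -> finer D D'].

Section example.
Context (R : realType).

Fixpoint cantor_stage (n : nat) : set R :=
  if n is m.+1 then
    [set x / 3 | x in cantor_stage m] `|` [set (x + 2) / 3 | x in cantor_stage m]
  else `[0, 1].

Definition cantor_ternary : set R := \bigcap_n cantor_stage n.

Definition K_set : set (R * R * R) :=
  (cantor_ternary `*` `[0, 1] `*` `[0, 1])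
  `|` (`[0, 1] `*` [set 0] `*` `[0, 1])
  `|` (`[0, 1] `*` `[0, 1] `*` [set 0]).

End example.

Arguments K_set R : clear implicits.

(* Main.v *)
Require Import Defs.
From HB Require Import structures.
From mathcomp Require Import all_boot all_order all_algebra.
From mathcomp Require Import all_classical all_reals all_analysis.
From mathcomp Require Import lra.
Import Order.TTheory GRing.Theory Num.Theory.
Import numFieldNormedType.Exports.

(** For c in the Cantor set, the slice of K over x = c is the square
    {c} x [0,1]^2; for any other x in [0,1] it is the L-shaped union of the two
    segments {(x, 0, z)} and {(x, y, 0)}. Hence both projections (x, y, z) |-> (x, z) and
    (x, y, z) |-> (x, y) map K onto the unit square with connected fibres
    ([proj_xz_fiber_connected], [proj_xy_fiber_connected]). A continuous map
    from a compact space to a Hausdorff space is closed, so its fibres form an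
    upper semi-continuous decomposition whose quotient is its image
    ([homeomorphic_fiber_quotient]). The two projections therefore give two
    monotone decompositions of K whose quotient, the square, is a Peano
    compactum.

    A core decomposition would refine both of them
    ([core_decomposition_fibers]), so two points in one of its blocks would have
    the same coordinates. Its blocks would be points, its quotient K itself, and
    the connected space K would be locally connected
    ([peano_quotient_locally_connected]). But near (0, 1, 1) every point of K
    has its first coordinate in the Cantor set, which accumulates at 0 and
    contains no interval [0, c] with c > 0 ([cantor_ternary_gap]), so (0, 1, 1) has no small
    connected neighbourhood ([K_not_locally_connected]). *)

Set Implicit Arguments.
Unset Strict Implicit.
Unset Printing Implicit Defensive.

Local Open Scope classical_set_scope.
Local Open Scope ring_scope.

(** * Subspaces, products and homeomorphisms *)

Section subspaces.
Context {T : topologicalType} {A : set T}.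
Implicit Type B : set (set_type A).

Lemma open_set_typeE (U : set (set_type A)) :
  open U = (exists2 W, open W & set_val @^-1` W = U).
Proof. by []. Qed.

Lemma connected_set_val B : connected (set_val @` B) -> connected B.
Proof.
move=> cB C [c Cc] [U + CU] [V + CV].
rewrite open_set_typeE -openC open_set_typeE => -[W oW WU] [Z oZ ZV].
rewrite -{U}WU in CU.
have CE : set_val @` C = set_val @` B.
  apply: cB; first by exists (set_val c); exists c.
    exists W => //; apply/seteqP; split => [_ [x Cx <-]|_ [[x Bx <-] Wx]].
      by move: Cx; rewrite CU => -[Bx Wx]; split=> //; exists x.
    by exists x => //; rewrite CU.
  exists (~` Z); first exact: open_closedC.
  have VE : V = ~` (set_val @^-1` Z) by rewrite ZV setCK.
  apply/seteqP; split => [_ [x Cx <-]|_ [[x Bx <-] Zx]].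
    by move: Cx; rewrite CV VE => -[Bx Wx]; split=> //; exists x.
  by exists x => //; rewrite CV VE.
apply/seteqP; split => [x|x Bx]; first by rewrite CU => -[].
have : (set_val @` C) (set_val x) by rewrite CE; exists x.
by move=> [y Cy /val_inj <-].
Qed.

Lemma compact_set_val B : compact (set_val @` B) -> compact B.
Proof.
move=> cB F PF FB.
have [|_ [[b Bb <-] cb]] := cB (set_val @ F) _.
  by rewrite /nbhs/=; apply: filterS FB => x Bx; exists x.
exists b; split => // P U FP [_ [[W oW <-] Wb] WU].
have FvP : (set_val @ F) (set_val @` P).
  by rewrite /nbhs/=; apply: filterS FP => x Px; exists x.
have [_ [[x Px <-] Wx]] := cb _ W FvP (open_nbhs_nbhs (conj oW Wb)).
by exists x; split => //; exact: WU.
Qed.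

Lemma set_val_continuous : continuous (set_val : set_type A -> T).
Proof. exact: initial_continuous. Qed.

Lemma set_val_setT : set_val @` [set: set_type A] = A.
Proof.
apply/seteqP; split => [_ [x _ <-]|x Ax]; first exact: set_valP.
by exists (SigSub (mem_set Ax)).
Qed.

Lemma compact_set_type : compact A -> compact [set: set_type A].
Proof. by move=> cA; apply: compact_set_val; rewrite set_val_setT. Qed.

Lemma connected_set_type : connected A -> connected [set: set_type A].
Proof. by move=> cA; apply: connected_set_val; rewrite set_val_setT. Qed.

End subspaces.

Lemma continuous_connected (X Y : topologicalType) (f : X -> Y) (A : set X) :
  continuous f -> connected A -> connected (f @` A).
Proof.
move=> cf cA; apply: connected_continuous_connected => //.
exact: continuous_subspaceT.
Qed.

Lemma continuous_pair (T X Y : topologicalType) (f : T -> X) (g : T -> Y) :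
  continuous f -> continuous g -> continuous (fun t => (f t, g t)).
Proof. by move=> cf cg t; apply: cvg_pair; [exact: cf|exact: cg]. Qed.

(** The product is covered by the crosses formed by a horizontal slice and one
    fixed vertical slice; all these crosses share that vertical slice. *)
Lemma connectedX (X Y : topologicalType) (A : set X) (B : set Y) :
  connected A -> connected B -> connected (A `*` B).
Proof.
move=> cA cB; have [->|/set0P[a Aa]] := eqVneq A set0.
  by rewrite set0X; exact: connected0.
have [->|/set0P[b0 Bb0]] := eqVneq B set0.
  by rewrite setX0; exact: connected0.
pose C b := (A `*` [set b]) `|` ([set a] `*` B).
have -> : A `*` B = \bigcup_(b in B) C b.
  apply/seteqP; split.
    by move=> [x y] [/= Ax By]; exists y => //; left.
  by move=> [x y] [b Bb [[/= Ax ->]|[/= -> By]]].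
apply: bigcup_connected; first by exists (a, b0) => b Bb; right.
move=> b Bb; apply: connectedU; first by exists (a, b).
  have -> : A `*` [set b] = (pair^~ b) @` A.
    by apply/seteqP; split=> [[x y] [/= Ax ->]|_ [x Ax <-]//]; exists x.
  by apply: continuous_connected => // x; apply: cvg_pair => //; exact: cvg_cst.
have -> : [set a] `*` B = (pair a) @` B.
  by apply/seteqP; split=> [[x y] [/= -> By]|_ [y By <-]//]; exists y.
by apply: continuous_connected => // y; apply: cvg_pair => //; exact: cvg_cst.
Qed.

Lemma homeomorphic_trans (X Y Z : topologicalType) :
  homeomorphic X Y -> homeomorphic Y Z -> homeomorphic X Z.
Proof.
move=> [f [f' [cf cf' fK f'K]]] [g [g' [cg cg' gK g'K]]].
exists (g \o f), (f' \o g'); split.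
- by move=> x; apply: continuous_comp; [exact: cf|exact: cg].
- by move=> x; apply: continuous_comp; [exact: cg'|exact: cf'].
- exact: can_comp.
- exact: can_comp.
Qed.

Lemma homeomorphic_sym (X Y : topologicalType) :
  homeomorphic X Y -> homeomorphic Y X.
Proof. by move=> [f [g [cf cg fK gK]]]; exists g, f. Qed.

Lemma homeomorphic_set_type_setT (X : topologicalType) :
  homeomorphic X (set_type [set: X]).
Proof.
exists (fun x => SigSub (mem_set (I : [set: X] x))), set_val; split => //.
- apply: (@continuous_comp_initial (set_type [set: X]) X X set_val) => x.
  exact: cvg_id.
- exact: set_val_continuous.
- by move=> x; exact: val_inj.
Qed.

Lemma homeomorphic_locally_connected (X Y : topologicalType) :
  homeomorphic X Y -> locally_connected Y -> locally_connected X.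
Proof.
move=> [f [g [cf cg fK gK]]] lY x U xU.
have : nbhs (f x) (g @^-1` U) by apply: cg; rewrite fK.
move=> /lY[V [oV Vfx cV VU]].
have fE : f @^-1` V = g @` V.
  apply/seteqP; split => [y Vy|_ [y Vy <-]]; last by rewrite /= gK.
  by exists (f y).
exists (f @^-1` V); split => //.
- by move/continuousP : cf; exact.
- by rewrite fE; exact: continuous_connected.
- by rewrite fE => _ [y Vy <-]; exact: VU.
Qed.

(** * Connected Peano compacta *)

Section peano_continua.
Context {R : realType}.

Lemma connected_components (T : topologicalType) : connected [set: T] ->
  forall A, components T A -> A = [set: T].
Proof.
move=> cT _ [x _ <-]; apply/seteqP; split => // y _.
exact: connected_component_max cT _ _.
Qed.

Lemma peano_compactum_connected (M : metricType R) : compact [set: M] ->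
  connected [set: M] -> locally_connected M -> peano_compactum M.
Proof.
move=> kM cM lM; split => // [A /(connected_components cM) ->|C C0].
  split => //; apply: homeomorphic_locally_connected lM.
  exact/homeomorphic_sym/homeomorphic_set_type_setT.
apply: (@sub_finite_set _ _ [set [set: M]]); last exact: finite_set1.
by move=> A [/(connected_components cM) ->].
Qed.

Lemma connected_peano_compactum (M : metricType R) : connected [set: M] ->
  peano_compactum M -> locally_connected M.
Proof.
move=> cM [_ pM _] x.
suff lM : locally_connected M by exact: lM.
have MT : components M [set: M].
  by exists x => //; apply: (connected_components cM); exists x.
have [_] := pM _ MT; apply: homeomorphic_locally_connected.
exact: homeomorphic_set_type_setT.
Qed.

End peano_continua.

(** * Decompositions into fibres *)

(** The generic projection [\pi] is locked, so this is not a conversion. *)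
Lemma pi_quotient_space (T : topologicalType) (D : usc_decomposition T) :
  (\pi_(quotient_space D))%qT = natural_projection D.
Proof. by rewrite unlock. Qed.

Lemma natural_projection_continuous (T : topologicalType)
  (D : usc_decomposition T) : continuous (natural_projection D).
Proof. by rewrite -pi_quotient_space; exact: pi_continuous. Qed.

Section fibers.
Context {T Y : topologicalType} (f : T -> Y).
Hypotheses (cf : continuous f) (kT : compact [set: T]) (hY : hausdorff_space Y).

Lemma closed_map_compact (C : set T) : closed C -> closed (f @` C).
Proof.
move=> cC; apply: compact_closed => //.
apply: continuous_compact; first exact: continuous_subspaceT.
exact: subclosed_compact kT _.
Qed.

Definition fibers : set (set T) := range (fun x => f @^-1` [set f x]).

Lemma fibers_partition : classical_sets.partition fibers id [set: T].
Proof.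
split.
- by apply/seteqP; split => // x _; exists (f @^-1` [set f x]) => //; exists x.
- by move=> _ _ [x _ <-] [y _ <-] [z [/= <- <-]].
- by move=> _ [x _ <-]; exists x.
Qed.

(** The fibres contained in [B] are those over the complement of the image of
    the complement of [B], and that image is closed. *)
Lemma fibers_usc (B : set T) : open B ->
  open (\bigcup_(d in [set d | fibers d /\ d `<=` B]) d).
Proof.
move=> oB.
have -> : \bigcup_(d in [set d | fibers d /\ d `<=` B]) d =
    f @^-1` (~` (f @` (~` B))).
  apply/seteqP; split => [x [_ [[y _ <-] sB] /= xy] [z nBz zx]|x nfx].
    by apply: nBz; apply: sB; rewrite /= zx.
  exists (f @^-1` [set f x]) => //; split; first by exists x.
  by move=> y /= yx; apply: contrapT => nBy; apply: nfx; exists y.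
move/continuousP : cf; apply; apply: closed_openC.
by apply: closed_map_compact; exact: open_closedC.
Qed.

Definition fiber_decomposition : usc_decomposition T :=
  UscDecomposition fibers_partition fibers_usc.

Let D := fiber_decomposition.

Lemma natural_projection_fiber x y :
  natural_projection D x = natural_projection D y <-> f x = f y.
Proof.
have mem z w : set_val (natural_projection D z) w <-> f w = f z.
  have [u _ uE] : fibers (set_val (natural_projection D z)) by exact: set_valP.
  have := block_of_mem D z; rewrite -/(natural_projection D z) -uE /= => ->.
  by split.
split=> [pxy|fxy]; first by rewrite -(mem y x) -pxy mem.
have [_ triv _] := fibers_partition.
apply: (val_inj : injective (set_val : block_type D -> set T)).
apply: triv; [exact: set_valP|exact: set_valP|].
by exists x; split; apply/mem.
Qed.

(** The inverse, which sends a point of [Y] to the fibre over it, is continuous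
    because [f] is a closed map. *)
Lemma homeomorphic_fiber_quotient : range f = [set: Y] ->
  homeomorphic (quotient_space D) Y.
Proof.
move=> fT; have g_ y : exists x, f x = y.
  by have : range f y; [rewrite fT|move=> [x _ <-]; exists x].
pose g y := sval (cid (g_ y)).
have gK y : f (g y) = y := svalP (cid (g_ y)).
pose h (d : quotient_space D) : Y := f (block_repr d).
have hE x : h (natural_projection D x) = f x.
  by apply/natural_projection_fiber; exact: (@block_reprK _ D).
exists h, (natural_projection D \o g); split.
- apply/quotient_continuous; rewrite pi_quotient_space.
  by have -> : h \o natural_projection D = f by apply/funext => x; exact: hE.
- apply/continuousP => A oA.
  have -> : (natural_projection D \o g) @^-1` A =
      ~` (f @` (~` (natural_projection D @^-1` A))).
    apply/seteqP; split => [y Ay [x nAx xy]|y nfy].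
      apply: nAx; rewrite /=.
      suff -> : natural_projection D x = natural_projection D (g y) by [].
      by apply/natural_projection_fiber; rewrite gK.
    by apply: contrapT => nAy; apply: nfy; exists (g y).
  apply: closed_openC; apply: closed_map_compact; apply: open_closedC.
  by move/continuousP : (@natural_projection_continuous T D); exact.
- move=> d; rewrite -[RHS](@block_reprK _ D d); apply/natural_projection_fiber.
  by rewrite gK.
- by move=> y; rewrite /= hE gK.
Qed.

End fibers.

(** * Core decompositions *)

Section core.
Context {R : realType} {T : topologicalType}.

Lemma homeomorphic_injective_quotient (D : usc_decomposition T) :
  injective (natural_projection D) -> homeomorphic T (quotient_space D).
Proof.
move=> injD.
have pK : cancel (natural_projection D) (@block_repr T D).
  by move=> x; apply: injD; exact: (@block_reprK _ D).
exists (natural_projection D), (@block_repr T D); split => //.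
- exact: natural_projection_continuous.
- apply/quotient_continuous; rewrite pi_quotient_space.
  have -> : @block_repr T D \o natural_projection D = id by exact/funext.
  by move=> x; exact: cvg_id.
- exact: (@block_reprK _ D).
Qed.

(** If all blocks are points then [T] is homeomorphic to a connected Peano
    compactum, which is its own and only component. *)
Lemma peano_quotient_locally_connected (D : usc_decomposition T) :
  connected [set: T] -> injective (natural_projection D) ->
  has_peano_quotient R D -> locally_connected T.
Proof.
move=> cT /homeomorphic_injective_quotient TD [M [DM pM]].
have TM := homeomorphic_trans TD DM.
apply: (homeomorphic_locally_connected TM).
apply: connected_peano_compactum pM.
have [f [g [cf _ _ gK]]] := TM.
have -> : [set: M] = f @` [set: T].
  by apply/seteqP; split => // y _; exists (g y).
exact: continuous_connected.
Qed.

(** A core decomposition is finer than the decomposition of [T] into the fibres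
    of any monotone map onto a Peano compactum. *)
Lemma core_decomposition_fibers (D : usc_decomposition T) (M : metricType R)
    (f : T -> M) :
  core_decomposition R D -> compact [set: T] -> peano_compactum M ->
  continuous f -> range f = [set: M] ->
  (forall y, continuum (f @^-1` [set y])) ->
  forall x y, natural_projection D x = natural_projection D y -> f x = f y.
Proof.
move=> [_ _ coreD] kT pM cf fT fib x y xy.
have hM := @metric_hausdorff _ M.
have [||g gE] := coreD (fiber_decomposition cf kT hM).
- by move=> _ [z _ <-]; exact: fib.
- by exists M; split => //; exact: homeomorphic_fiber_quotient.
- apply/(natural_projection_fiber cf kT hM).
  by rewrite gE /= xy.
Qed.

End core.

(** * The unit square *)

Section square.
Context {R : realType}.

(** A type of its own, so that it can carry the metric below in addition to the
    topology of the subspace. *)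
Definition square : Type := set_type (`[0 : R, 1] `*` `[0 : R, 1]).

HB.instance Definition _ := PseudoMetric.on square.

Definition square_dist (p q : square) : R := `|set_val p - set_val q|.

Lemma square_dist_ge0 p q : 0 <= square_dist p q.
Proof. exact: normr_ge0. Qed.

Lemma square_dist_eq0 p q : square_dist p q = 0 -> p = q.
Proof. by move/normr0_eq0/subr0_eq/val_inj. Qed.

Lemma ball_square_dist (p : square) d :
  ball p d = [set q | square_dist p q < d].
Proof. by rewrite /square_dist -[LHS]initial_ballE -ball_normE. Qed.

HB.instance Definition _ := PseudoMetric_isMetric.Build R square
  square_dist_ge0 square_dist_eq0 ball_square_dist.

Lemma square_compact : compact [set: square].
Proof.
by apply: compact_set_type; apply: compact_setX; exact: segment_compact.
Qed.

Lemma square_connected : connected [set: square].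
Proof.
by apply: connected_set_type; apply: connectedX; exact: segment_connected.
Qed.

(** A ball of the maximum norm meets the square in a product of intervals. *)
Lemma square_locally_connected : locally_connected square.
Proof.
move=> p U /nbhs_ballP[e /= e0 pU].
pose I (a : R) : set R := ball a e `&` `[0 : R, 1].
have I_connected a : connected (I a).
  apply/connected_intervalP => x y [ax /= x01] [ay /= y01] z xzy.
  move: ax ay x01 y01 xzy; rewrite /I /= -!ball_normE /= !in_itv /= !ltr_distl.
  lra.
pose V : set (set_type (`[0 : R, 1] `*` `[0, 1])) :=
  set_val @^-1` ball (set_val p) e.
exists V; split.
- by exists (ball (set_val p) e) => //; exact: ball_open.
- exact: ballxx.
- apply: connected_set_val.
  have -> : set_val @` V = I (set_val p).1 `*` I (set_val p).2.
    apply/seteqP; split => [_ [q [b1 b2] <-]|[x y] [/= [bx x01] [b_y y01]]].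
      by have [q1 q2] := set_valP q; split.
    by exists (SigSub (mem_set (conj x01 y01 : (_ `*` _) (x, y)))).
  by apply: connectedX.
- by move=> q; exact: pU.
Qed.

Lemma square_peano_compactum : peano_compactum square.
Proof.
apply: peano_compactum_connected.
- exact: square_compact.
- exact: square_connected.
- exact: square_locally_connected.
Qed.

End square.
Arguments square R : clear implicits.

(** * The Cantor set *)

Section cantor.
Context {R : realType}.
Let C := @cantor_ternary R.

Lemma cantor_ternary_sub01 : C `<=` `[0, 1].
Proof. by move=> x /(_ 0 I). Qed.

Lemma cantor_stage_compact n : compact (@cantor_stage R n).
Proof.
elim: n => [|n IHn]; first exact: segment_compact.
apply: compactU; apply: continuous_compact => //.
  apply: continuous_subspaceT => x.
  by apply: cvgM; [exact: cvg_id|exact: cvg_cst].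
apply: continuous_subspaceT => x; apply: cvgM; last exact: cvg_cst.
by apply: cvgD; [exact: cvg_id|exact: cvg_cst].
Qed.

Lemma cantor_ternary_compact : compact C.
Proof.
apply: (subclosed_compact _ (@segment_compact R 0 1) cantor_ternary_sub01).
apply: closed_bigI => n _; apply: compact_closed; first exact: Rhausdorff.
exact: cantor_stage_compact.
Qed.

Lemma cantor_ternary0 : C 0.
Proof.
move=> n _; elim: n => [|n IHn] /=; first by rewrite in_itv /= lexx ler01.
by left; exists 0; rewrite // mul0r.
Qed.

Lemma cantor_ternary1 : C 1.
Proof.
move=> n _; elim: n => [|n IHn] /=; first by rewrite in_itv /= lexx ler01.
by right; exists 1 => //; lra.
Qed.

Lemma cantor_stage_sub01 n : @cantor_stage R n `<=` `[0, 1].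
Proof.
elim: n => [//|n IHn] _ [] [x /IHn + <-]; rewrite /= !in_itv /=; lra.
Qed.

Lemma cantor_ternary_third x : C x -> C (x / 3).
Proof.
move=> Cx [|n] _; last by left; exists x => //; exact: Cx.
by have := cantor_ternary_sub01 Cx; rewrite /= !in_itv /=; lra.
Qed.

(** For [x <= 1] the point [x / 3] lies below the right-hand copy
    [(C + 2) / 3], so it comes from the left-hand copy [C / 3]. *)
Lemma cantor_ternary_triple x : x <= 1 -> C (x / 3) -> C x.
Proof.
move=> x1 Cx n _.
have [[y Cy yx]|[y Cy yx]] := Cx n.+1 I.
  by have -> : x = y by lra.
have := @cantor_stage_sub01 n _ Cy; rewrite /= in_itv /=; lra.
Qed.

(** The witnesses are [3 ^ -n], obtained from [1] by repeated division by three,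
    and half of it: by self-similarity, if the latter were in the Cantor set, so
    would be [1 / 2]. *)
Lemma cantor_ternary_gap e : 0 < e ->
  exists c m : R, [/\ C c, ~ C m, 0 < m < c & c < e].
Proof.
move=> e0.
have C3 n : C (3^-1 ^+ n).
  elim: n => [|n IHn]; first by rewrite expr0; exact: cantor_ternary1.
  by rewrite exprSr; exact: cantor_ternary_third.
have nC2 n : ~ C (3^-1 ^+ n / 2).
  elim: n => [|n IHn].
    rewrite expr0 => /(_ 1 I) [] [y]; rewrite /= in_itv /=; lra.
  rewrite exprSr mulrAC => /cantor_ternary_triple H; apply: IHn; apply: H.
  have : 3^-1 ^+ n <= 1 :> R by apply: exprn_ile1; lra.
  lra.
have [n ne] : exists n, 3^-1 ^+ n < e.
  have : (fun n => 3^-1 ^+ n : R) @ \oo --> 0.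
    by apply: cvg_expr; rewrite gtr0_norm; lra.
  move/cvgr0_norm_lt => /(_ e e0)[n _ /(_ n (leqnn n))] /=.
  by exists n; apply: le_lt_trans; first exact: ler_norm.
exists (3^-1 ^+ n), (3^-1 ^+ n / 2); split => //.
have : 0 < 3^-1 ^+ n :> R by apply: exprn_gt0; lra.
lra.
Qed.

End cantor.

(** * The space K and its two projections *)

Section example.
Context {R : realType}.
Let C := @cantor_ternary R.
Let K := set_type (K_set R).

Lemma K_setP (x y z : R) : K_set R (x, y, z) <->
  [/\ x \in `[0, 1], y \in `[0, 1], z \in `[0, 1] & [\/ C x, y = 0 | z = 0]].
Proof.
have I0 : (0 : R) \in `[0, 1] by rewrite in_itv /= lexx ler01.
split=> [[[|]|]|[x01 y01 z01 [Cx|->|->]]].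
- move=> [[Cx y01] z01]; split => //; first exact: cantor_ternary_sub01.
  by constructor 1.
- by move=> [[x01 /= ->] z01]; split => //; constructor 2.
- by move=> [[x01 y01] /= ->]; split => //; constructor 3.
- by left; left.
- by left; right.
- by right.
Qed.

Lemma xz_in_square (p : K) :
  (`[0 : R, 1] `*` `[0, 1]) ((set_val p).1.1, (set_val p).2).
Proof. by case: p => [[[x y] z] /= /set_mem/K_setP[]]. Qed.

Lemma xy_in_square (p : K) : (`[0 : R, 1] `*` `[0, 1]) (set_val p).1.
Proof. by case: p => [[[x y] z] /= /set_mem/K_setP[]]. Qed.

Definition proj_xz (p : K) : square R := SigSub (mem_set (xz_in_square p)).
Definition proj_xy (p : K) : square R := SigSub (mem_set (xy_in_square p)).

Lemma square_valued_continuous (T : topologicalType) (f : T -> square R) :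
  continuous (fun t => set_val (f t) : R * R) -> continuous f.
Proof. exact: continuous_comp_initial. Qed.

Lemma set_valK_continuous : continuous (fun p : K => set_val p : R * R * R).
Proof. exact: set_val_continuous. Qed.

Lemma proj_xy_continuous : continuous proj_xy.
Proof.
apply: square_valued_continuous => p.
apply: (continuous_comp (@set_valK_continuous p)); exact: cvg_fst.
Qed.

Lemma xcoord_continuous : continuous (fun p : K => (set_val p).1.1).
Proof.
move=> p; apply: (@continuous_comp _ _ _ (fun p : K => (set_val p).1) fst).
  by apply: (continuous_comp (@set_valK_continuous p)); exact: cvg_fst.
exact: cvg_fst.
Qed.

Lemma proj_xz_continuous : continuous proj_xz.
Proof.
apply: square_valued_continuous.
apply: continuous_pair; first exact: xcoord_continuous.
by move=> p; apply: (continuous_comp (@set_valK_continuous p)); exact: cvg_snd.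
Qed.

Lemma proj_xz_surjective : range proj_xz = [set: square R].
Proof.
apply/seteqP; split => // -[[x z] xz] _.
have [x01 z01] := set_mem xz.
have Kp : K_set R (x, 0, z).
  by apply/K_setP; split => //; [rewrite /= in_itv /= lexx ler01|constructor 2].
by exists (SigSub (mem_set Kp)) => //; exact: val_inj.
Qed.

Lemma proj_xy_surjective : range proj_xy = [set: square R].
Proof.
apply/seteqP; split => // -[[x y] xy] _.
have [x01 y01] := set_mem xy.
have Kp : K_set R (x, y, 0).
  by apply/K_setP; split => //; [rewrite /= in_itv /= lexx ler01|constructor 3].
by exists (SigSub (mem_set Kp)) => //; exact: val_inj.
Qed.

Lemma K_compact : compact (K_set R).
Proof.
have kI := @segment_compact R 0 1; have kC := @cantor_ternary_compact R.
apply: compactU; first apply: compactU.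
- by apply: compact_setX => //; exact: compact_setX.
- apply: compact_setX => //; apply: compact_setX => //; exact: compact_set1.
- apply: compact_setX; last exact: compact_set1.
  exact: compact_setX.
Qed.

(** The set is the whole interval if [P] holds and the point [0] otherwise; these
    are the two shapes of the fibres of [proj_xz] and [proj_xy]. *)
Lemma interval_section (P : Prop) :
  connected [set y : R | y \in `[0, 1] /\ (P \/ y = 0)].
Proof.
apply/connected_intervalP => u v [u01 Pu] [v01 Pv] y uyv.
split; first by move: u01 v01; rewrite /= !in_itv /=; lra.
have [p|nP] := pselect P; first by left.
right; case: Pu Pv uyv => [//|->] [//|->]; lra.
Qed.

(** The fibre over [(x, z)] is a copy of [[0, 1]] if [x] is in the Cantor set or
    [z = 0], and the point [(x, 0, z)] otherwise. *)
Lemma proj_xz_fiber_connected (q : square R) :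
  connected (proj_xz @^-1` [set q]).
Proof.
case: q => [[x z] xz]; have [/= x01 z01] := set_mem xz.
apply: connected_set_val.
have -> : set_val @` (proj_xz @^-1` [set SigSub xz]) =
    (fun y => (x, y, z)) @` [set y | y \in `[0, 1] /\ ((C x \/ z = 0) \/ y = 0)].
  apply/seteqP; split => [_ [[[[x' y] z'] Kp] /= [ex ez] <-]|].
    have /K_setP[_ y01 _ K4] := set_mem Kp.
    rewrite -ex -ez; exists y => //; split => //.
    by case: K4 => ?; [left; left|right|left; right].
  move=> _ [y [y01 H] <-].
  have Kp : K_set R (x, y, z).
    apply/K_setP; split => //.
    by case: H => [[?|?]|?]; [constructor 1|constructor 3|constructor 2].
  by exists (SigSub (mem_set Kp)) => //; exact: val_inj.
apply: continuous_connected; last exact: interval_section.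
apply: continuous_pair; last by move=> y; exact: cvg_cst.
by apply: continuous_pair => y; [exact: cvg_cst|exact: cvg_id].
Qed.

Lemma proj_xy_fiber_connected (q : square R) :
  connected (proj_xy @^-1` [set q]).
Proof.
case: q => [[x y] xy]; have [/= x01 y01] := set_mem xy.
apply: connected_set_val.
have -> : set_val @` (proj_xy @^-1` [set SigSub xy]) =
    (fun z => (x, y, z)) @` [set z | z \in `[0, 1] /\ ((C x \/ y = 0) \/ z = 0)].
  apply/seteqP; split => [_ [[[[x' y'] z] Kp] /= [ex ey] <-]|].
    have /K_setP[_ _ z01 K4] := set_mem Kp.
    rewrite -ex -ey; exists z => //; split => //.
    by case: K4 => ?; [left; left|left; right|right].
  move=> _ [z [z01 H] <-].
  have Kp : K_set R (x, y, z).
    apply/K_setP; split => //.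
    by case: H => [[?|?]|?]; [constructor 1|constructor 2|constructor 3].
  by exists (SigSub (mem_set Kp)) => //; exact: val_inj.
apply: continuous_connected; last exact: interval_section.
by apply: continuous_pair => y'; [exact: cvg_cst|exact: cvg_id].
Qed.

Lemma fiber_continuum (f : K -> square R) : continuous f ->
  (forall q, connected (f @^-1` [set q])) ->
  forall q, continuum (f @^-1` [set q]).
Proof.
move=> cf cfib q; split => //.
apply: (@subclosed_compact _ _ [set: K]) => //; last first.
  exact: compact_set_type K_compact.
move/continuous_closedP : cf; apply.
by apply: compact_closed; [exact: metric_hausdorff|exact: compact_set1].
Qed.

(** Each fibre of [proj_xz] meets the square [y = 0], which is connected. *)
Lemma K_connected : connected (K_set R).
Proof.
have I0 : (0 : R) \in `[0, 1] by rewrite in_itv /= lexx ler01.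
pose wall := (fun u : R * R => (u.1, 0 : R, u.2)) @` (`[0, 1] `*` `[0, 1]).
have cwall : connected wall.
  apply: continuous_connected.
    apply: continuous_pair; last by move=> u; exact: cvg_snd.
    by apply: continuous_pair => u; [exact: cvg_fst|exact: cvg_cst].
  by apply: connectedX; exact: segment_connected.
pose fib (p : K) := set_val @` (proj_xz @^-1` [set proj_xz p]).
have -> : K_set R = \bigcup_(p in [set: K]) (wall `|` fib p).
  apply/seteqP; split => [v Kv|v [p _ [[[x z] [x01 z01] <-]|[q _ <-]]]].
  - by exists (SigSub (mem_set Kv)) => //; right; exists (SigSub (mem_set Kv)).
  - by apply/K_setP; split => //; constructor 2.
  - exact: set_valP.
apply: bigcup_connected.
  by exists (0, 0, 0) => p _; left; exists (0, 0).
move=> p _; apply: connectedU => //.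
  have [x01 z01] := xz_in_square p.
  have Kq : K_set R ((set_val p).1.1, 0, (set_val p).2).
    by apply/K_setP; split => //; constructor 2.
  exists ((set_val p).1.1, 0, (set_val p).2); split.
    by exists ((set_val p).1.1, (set_val p).2).
  by exists (SigSub (mem_set Kq)) => //; exact: val_inj.
apply: continuous_connected; first exact: set_valK_continuous.
exact: proj_xz_fiber_connected.
Qed.

(** Where [y] and [z] are positive, the first coordinate takes its values in the
    Cantor set, so it cannot take both values [0] and [c > 0] on a connected set
    if there is a gap between them; but a neighbourhood of [(0, 1, 1)] contains
    [(c, 1, 1)] for such [c]. *)
Lemma K_not_locally_connected : ~ locally_connected K.
Proof.
have I0 : (0 : R) \in `[0, 1] by rewrite in_itv /= lexx ler01.
have I1 : (1 : R) \in `[0, 1] by rewrite in_itv /= lexx ler01.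
have Kc c : C c -> K_set R (c, 1, 1).
  move=> Cc; apply/K_setP; split => //; last by constructor 1.
  exact: cantor_ternary_sub01.
pose pt c Cc : K := SigSub (mem_set (Kc c Cc)).
pose U : set K := set_val @^-1` ball (0 : R, 1 : R, 1 : R) 1.
have C0 := @cantor_ternary0 R.
have nU : nbhs (pt 0 C0) U.
  by apply: set_valK_continuous; exact: nbhsx_ballx.
move=> /(_ _ _ nU)[V [oV V0 cV VU]].
have [W oW WV] : exists2 W, open W & set_val @^-1` W = V by [].
have : nbhs (0 : R, 1 : R, 1 : R) W.
  by apply: open_nbhs_nbhs; split => //; move: V0; rewrite -WV.
move=> /nbhs_ballP[e /= e0 eW].
have [c [m [Cc nCm m0c ce]]] := @cantor_ternary_gap R e e0.
have Vc : V (pt c Cc).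
  rewrite -WV; apply: eW; split; last exact: ballxx.
  split; last exact: ballxx.
  by rewrite -ball_normE /= sub0r normrN gtr0_norm; lra.
have /connected_intervalP ix := continuous_connected xcoord_continuous cV.
have [|||q Vq qm] := ix 0 c _ _ m.
- by exists (pt 0 C0).
- by exists (pt c Cc).
- lra.
apply: nCm; rewrite -qm.
have [[_ yq] zq] := VU _ Vq.
move: yq zq; rewrite -!ball_normE /= !ltr_distl.
case: q {Vq qm} => [[[x' y] z] Kq] /= y0 z0.
by have /K_setP[_ _ _ [//| |]] := set_mem Kq; lra.
Qed.

End example.

Theorem mainTheorem8 (R : realType) :
  continuum (K_set R) /\
  ~ exists D : usc_decomposition (set_type (K_set R)), core_decomposition R D.
Proof.
split; first by split; [exact: K_compact|exact: K_connected].
move=> [D coreD].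
have kK := compact_set_type (@K_compact R).
have sq := @square_peano_compactum R.
apply: (@K_not_locally_connected R).
have [_ pD _] := coreD.
apply: (peano_quotient_locally_connected _ _ pD).
  exact/connected_set_type/K_connected.
move=> p q pq.
have xz := core_decomposition_fibers coreD kK sq proj_xz_continuous
  proj_xz_surjective
  (fiber_continuum proj_xz_continuous proj_xz_fiber_connected) pq.
have xy := core_decomposition_fibers coreD kK sq proj_xy_continuous
  proj_xy_surjective
  (fiber_continuum proj_xy_continuous proj_xy_fiber_connected) pq.
have e1 : (set_val p).1 = (set_val q).1 := congr1 set_val xy.
have e2 : (set_val p).2 = (set_val q).2 := congr1 (snd \o set_val) xz.
apply: val_inj; move: e1 e2.
by case: p {xz xy pq} => [[? ?] ?]; case: q => [[? ?] ?] /= -> ->.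
Qed.
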